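(* Let $n\ge 2$. The following bounds hold, for every integer $j\ge 0$. (a) For every solid harmonic $Q_j\in\mathcal H_j(\mathbb R^n)$ and every multi-index $\alpha\in\mathbb N^n$, $\alpha\neq 0$, $$\|\partial^{\alpha}Q_j\|_{L^{\infty}(\mathbb S^{n-1})}\leq e^{\frac{n}{4}-\frac{1}{2}}\sqrt{n}\; 2^{\frac{|\alpha|}{2}}\, j^{|\alpha|+\frac{n}{2}-1}\,\|Q_j\|_{L^{\infty}(\mathbb S^{n-1})}.$$ (b) For every spherical harmonic $Y_j\in\mathcal H_j(\mathbb S^{n-1})$ and every multi-index $\alpha\in\mathbb N^{n-1}$, $\alpha\neq 0$, $$\|\partial^{\alpha}_{\theta}(Y_j\circ \mathfrak{p}) \|_{L^{\infty}(\mathbb{R}^{n-1})}\leq e^{\frac{n}{4}-\frac{1}{2}}\sqrt{n}\, \left( (n+1)^{|\alpha|}-1 \right)2^{\frac{|\alpha|}{2}}\,j^{|\alpha|+\frac{n}{2}-1}\, \|Y_j\|_{L^{\infty}(\mathbb S^{n-1})}.$$ (c) For every spherical harmonic $Y_j\in\mathcal H_j(\mathbb S^{n-1})$, every multi-index $\alpha\in\mathbb N^n$, $\alpha\neq 0$, and every $\varepsilon>0$, $$\|\partial^{\alpha}_{\mathbb S^{n-1}}Y_j\|_{L^{\infty}(\mathbb{S}^{n-1})}\leq e^{n\left(\frac{1}{4}+\sqrt{2}+3\sqrt{2+4/\varepsilon}\right) -\frac{1}{2} }\,n^{\frac{|\alpha|+1}{2}}\, (2+\varepsilon)^{|\alpha|}\,j^{|\alpha|+\frac{n}{2}-1}\,|\alpha|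 !\, \|Y_j\|_{L^{\infty}(\mathbb S^{n-1})}.$$
   Context: $\mathbb S^{n-1}$ is the Euclidean unit sphere of $\mathbb R^n$ and $\mathbb N=\{0,1,2,\dots\}$. $\mathcal H_j(\mathbb R^n)$ is the space of solid harmonics of degree $j$, i.e. harmonic homogeneous polynomials of degree $j$ on $\mathbb R^n$; $\mathcal H_j(\mathbb S^{n-1})$ is the space of spherical harmonics of degree $j$, i.e. restrictions to $\mathbb S^{n-1}$ of elements of $\mathcal H_j(\mathbb R^n)$. For a function $F$ on $\mathbb R^n$, $\|F\|_{L^\infty(\mathbb S^{n-1})}$ denotes the sup norm of its restriction to $\mathbb S^{n-1}$. Spherical coordinates: $\mathfrak p:\mathbb R^{n-1}\to\mathbb S^{n-1}$ is $$\mathfrak{p}(\theta)=(\cos\theta_1,\ \sin\theta_1\cos\theta_2,\ \dots,\ \sin\theta_1\cdots\sin\theta_{n-2}\cos\theta_{n-1},\ \sin\theta_1\cdots\sin\theta_{n-2}\sin\theta_{n-1}),$$ and $\partial_\theta^\alpha$ denotes partial differentiation in $\theta\in\mathbb R^{n-1}$. For a smooth function $\varphi$ on $\mathbb S^{n-1}$, its homogeneous extension of order $0$ is $\varphi^{\upharpoonright}(x)=\varphi(x/|x|)$, $x\in\mathbb R^n\setminus\{0\}$, and $(\partial^\alpha_{\mathbb S^{n-1}}\varphi)(\omega)=(\partial^\alpha\varphi^{\upharpoonright})(\omega)$ for $\omega\in\mathbb S^{n-1}$, $\alpha\in\mathbb N^n$. *)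

(* Defs.v *)
From HB Require Import structures.
From mathcomp Require Import all_boot all_order all_algebra.
From mathcomp Require Import all_classical all_reals all_analysis.
From mathcomp Require Import complex.
(* The notations of mpoly, which clash with those of mathcomp-analysis, are
   left out. *)
From mathcomp Require Import -(notations) mpoly.
Set Implicit Arguments.
Unset Strict Implicit.
Unset Printing Implicit Defensive.
Import Order.TTheory GRing.Theory Num.Theory numFieldNormedType.Exports.
Local Open Scope classical_set_scope.
Local Open Scope ring_scope.
Local Open Scope complex_scope.

(* Functions are complex-valued (real-valued ones being a special case), and
   multi-indices in N^n are the multinomials [multinom n], of length
   [mdeg]. *)

(* The library norm `|x| on 'rV[R]_n is the sup norm, whence these. *)
Definition enorm (R : realType) (n : nat) (x : 'rV[R]_n) : R :=
  Num.sqrt (\sum_(i < n) x 0 i ^+ 2).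

Definition sphere (R : realType) (n : nat) : set 'rV[R]_n :=
  [set x | enorm x = 1].

(* Extended-real valued, so that it is +oo for a function unbounded on A. *)
Definition supnorm (R : realType) (T : Type) (A : set T) (F : T -> R[i]) :
    \bar R :=
  ereal_sup [set (Normc.normc (F x))%:E | x in A].

(* R[i] has no structure of normed space over R in the library: differentiate
   real and imaginary parts separately. *)
Definition pderiv (R : realType) (n : nat) (i : 'I_n) (F : 'rV[R]_n -> R[i]) :
    'rV[R]_n -> R[i] :=
  fun x => 'D_(delta_mx 0 i) (fun y => complex.Re (F y)) x
        +i* 'D_(delta_mx 0 i) (fun y => complex.Im (F y)) x.

(* d_0^(a 0) (d_1^(a 1) (... (d_(n-1)^(a (n-1)) F))) *)
Definition mpderiv (R : realType) (n : nat) (a : multinom n)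
    (F : 'rV[R]_n -> R[i]) : 'rV[R]_n -> R[i] :=
  foldr (fun i G => iter (a i) (pderiv i) G) F
        (enum 'I_n).

Definition laplacian (R : realType) (n : nat) (F : 'rV[R]_n -> R[i]) :
    'rV[R]_n -> R[i] :=
  fun x => \sum_(i < n) pderiv i (pderiv i F) x.

(* The zero polynomial is j-homogeneous for every j. *)
Definition homogeneous_poly_fun (R : realType) (n j : nat)
    (F : 'rV[R]_n -> R[i]) : Prop :=
  exists2 p : mpoly n R[i], p \is ishomog1 j mdeg
    & forall x, F x = meval (fun i => (x 0 i)%:C) p.

Definition solid_harmonic (R : realType) (n j : nat) (Q : 'rV[R]_n -> R[i]) :
    Prop :=
  homogeneous_poly_fun j Q /\ forall x, laplacian Q x = 0.

(* A function on the sphere is represented by any function on the ambient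
   space; its values off the sphere play no role. *)
Definition spherical_harmonic (R : realType) (n j : nat)
    (Y : 'rV[R]_n -> R[i]) : Prop :=
  exists2 Q : 'rV[R]_n -> R[i], solid_harmonic j Q
    & {in @sphere R n, Y =1 Q}.

(* With 0-based indices, coordinate k is
   sin t_0 ... sin t_(k-1) cos t_k for k < n-1; for k = n-1 the second product
   is empty, so there is no cosine factor. *)
Definition sph_coord (R : realType) (n : nat) (t : 'rV[R]_n.-1) : 'rV[R]_n :=
  \row_(k < n) (\prod_(i < n.-1 | (i < k)%N) sin (t 0 i) *
                \prod_(i < n.-1 | (i == k :> nat)%N) cos (t 0 i)).

(* Meaningful for x != 0 only. *)
Definition homext (R : realType) (n : nat) (phi : 'rV[R]_n -> R[i]) :
    'rV[R]_n -> R[i] :=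
  fun x => phi ((enorm x)^-1 *: x).

Definition sphere_deriv (R : realType) (n : nat) (a : multinom n)
    (phi : 'rV[R]_n -> R[i]) : 'rV[R]_n -> R[i] :=
  mpderiv a (homext phi).

(* Main.v *)
Require Import Defs.
From HB Require Import structures.
From mathcomp Require Import all_boot all_order all_algebra.
From mathcomp Require Import all_classical all_reals all_analysis.
From mathcomp Require Import complex.
From mathcomp Require Import -(notations) mpoly.
From mathcomp Require Import ring lra zify.
Import Order.TTheory GRing.Theory Num.Theory numFieldNormedType.Exports.
Local Open Scope classical_set_scope.
Local Open Scope ring_scope.
Set Implicit Arguments.
Unset Strict Implicit.
Unset Printing Implicit Defensive.

(** Everything follows from Bernstein's inequality with its sharp constant, in
    the form of M. Riesz' interpolation formula.

    Let [w_r] run over the [2N] roots of [w^(2N) = -1]. By discrete Fourier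
    inversion, [k - N = \sum_r c_r w_r^k] for [0 <= k <= 2N], where
    [c_r = (2N)^-1 \sum_(k < 2N) (k - N) w_r^-k]. This sums to
    [N^-1 v / (1 - v)^2] with [v = w_r^-1], which is real and negative, and
    [k = 0] gives [\sum_r |c_r| = N]. Hence the derivative of a trigonometric
    polynomial of degree [N] is a fixed combination, of total mass [N], of its
    translates.

    (a) Split the [i]-th basis vector at a point [x] of the sphere into its
    radial and tangential parts. Euler's identity handles the first, and Riesz'
    formula on a great circle the second, so each derivative of a homogeneous
    polynomial of degree [d] costs a factor [sqrt 2 * d].

    (b) In each angle, [Y] composed with the spherical coordinates is a
    trigonometric polynomial of degree at most [j], so each derivative costs a
    factor [j].

    (c) The [k]-th derivatives of the extension are [P(x) / |x|^(j + 2k)] with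
    [P] homogeneous of degree [j + k], and differentiating once more multiplies
    the sup norm of the numerator by at most [j + 2k]. Finally
    [\prod_(k < m) (j + 2k) <= 2^m m! j^m]. *)

(** * Derivatives of complex-valued functions *)

Local Notation normc := Normc.normc.

Lemma normcE (R : realType) (z : R[i]) : `|z| = (normc z)%:C%C.
Proof. by []. Qed.

Lemma normc_ge0 (R : realType) (z : R[i]) : 0 <= normc z.
Proof. by case: z => a b; exact: sqrtr_ge0. Qed.

Lemma normc_le (R : realType) (z : R[i]) (a : R) :
  (normc z <= a) = (`|z| <= a%:C%C).
Proof. by rewrite normcE lecR. Qed.

Lemma normc_sum (R : realType) (I : Type) (r : seq I) (P : pred I)
    (F : I -> R[i]) :
  normc (\sum_(i <- r | P i) F i) <= \sum_(i <- r | P i) normc (F i).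
Proof. by rewrite normc_le rmorph_sum /=; exact: ler_norm_sum. Qed.

Lemma normc_nat (R : realType) (k : nat) : normc (k%:R : R[i]) = k%:R.
Proof. by apply: complexI; rewrite -normcE normr_nat rmorph_nat. Qed.

Lemma normc_real (R : realType) (a : R) : normc (a%:C%C) = `|a|.
Proof. by rewrite /= expr0n addr0 sqrtr_sqr. Qed.

Lemma ReM (R : realType) (z w : R[i]) :
  complex.Re (z * w) =
  complex.Re z * complex.Re w - complex.Im z * complex.Im w.
Proof. by case: z; case: w. Qed.

Lemma ImM (R : realType) (z w : R[i]) :
  complex.Im (z * w) =
  complex.Re z * complex.Im w + complex.Im z * complex.Re w.
Proof. by case: z; case: w. Qed.

Lemma ReD (R : realType) (z w : R[i]) :
  complex.Re (z + w) = complex.Re z + complex.Re w.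
Proof. by case: z; case: w. Qed.

Lemma ImD (R : realType) (z w : R[i]) :
  complex.Im (z + w) = complex.Im z + complex.Im w.
Proof. by case: z; case: w. Qed.

(** A relation rather than a value: it carries differentiability, so the usual rules compose and
    [is_cderive_unique] can equate two computations of one derivative. *)
Definition is_cderive (R : realType) (V : normedModType R) (x v : V)
    (F : V -> R[i]) (l : R[i]) : Prop :=
  is_derive x v (fun y => complex.Re (F y)) (complex.Re l) /\
  is_derive x v (fun y => complex.Im (F y)) (complex.Im l).

Lemma is_cderive_pderiv (R : realType) (n : nat) (i : 'I_n)
    (F : 'rV[R]_n -> R[i]) (x : 'rV[R]_n) (l : R[i]) :
  is_cderive x (delta_mx 0 i) F l -> pderiv i F x = l.
Proof. by case: l => a b [[_ Fa] [_ Fb]]; rewrite /pderiv Fa Fb. Qed.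

Lemma is_cderive_unique (R : realType) (V : normedModType R) (x v : V)
    (F : V -> R[i]) (l l' : R[i]) :
  is_cderive x v F l -> is_cderive x v F l' -> l = l'.
Proof.
case: l l' => [a b] [c d] [[_ Fa] [_ Fb]] [[_ Fc] [_ Fd]].
by rewrite -[a]Fa -[b]Fb -[c]Fc -[d]Fd.
Qed.

Lemma is_cderive_near (R : realType) (V : normedModType R) (x v : V)
    (F G : V -> R[i]) (l : R[i]) :
  (\near x, F x = G x) -> is_cderive x v F l -> is_cderive x v G l.
Proof.
move=> FG [dR dI]; split.
  by apply: near_eq_is_derive dR; apply: filterS FG => y ->.
by apply: near_eq_is_derive dI; apply: filterS FG => y ->.
Qed.

Lemma is_cderive_eq (R : realType) (V : normedModType R) (x v : V)
    (F G : V -> R[i]) (l k : R[i]) :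
  is_cderive x v F l -> F =1 G -> l = k -> is_cderive x v G k.
Proof. by move=> dF /funext <- <-. Qed.

Lemma is_cderive_cst (R : realType) (V : normedModType R) (x v : V)
    (c : R[i]) : is_cderive x v (fun=> c) 0.
Proof. by split; exact: is_derive_cst. Qed.

Lemma is_cderiveD (R : realType) (V : normedModType R) (x v : V)
    (F G : V -> R[i]) (l k : R[i]) :
  is_cderive x v F l -> is_cderive x v G k ->
  is_cderive x v (fun y => F y + G y) (l + k).
Proof.
move=> [dF dF'] [dG dG']; split.
  rewrite ReD [X in is_derive _ _ X _](_ : _ =
    (fun y => complex.Re (F y)) + (fun y => complex.Re (G y))).
    exact: is_deriveD.
  by apply/funext => y; rewrite ReD.
rewrite ImD [X in is_derive _ _ X _](_ : _ =
  (fun y => complex.Im (F y)) + (fun y => complex.Im (G y))).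
  exact: is_deriveD.
by apply/funext => y; rewrite ImD.
Qed.

Lemma is_cderiveM (R : realType) (V : normedModType R) (x v : V)
    (F G : V -> R[i]) (l k : R[i]) :
  is_cderive x v F l -> is_cderive x v G k ->
  is_cderive x v (fun y => F y * G y) (l * G x + F x * k).
Proof.
move=> [dF dF'] [dG dG']; split.
  rewrite [X in is_derive _ _ X _](_ : _ =
    (fun y => complex.Re (F y)) * (fun y => complex.Re (G y)) -
    (fun y => complex.Im (F y)) * (fun y => complex.Im (G y))); last first.
    by apply/funext => y; rewrite ReM.
  apply: is_derive_eq (is_deriveB (is_deriveM dF dG) (is_deriveM dF' dG')) _.
  rewrite ReD !ReM /GRing.scale/=.
  move: (F x) (G x) l k {dF dF' dG dG'} => [a b] [c d] [e f] [g h] /=; ring.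
rewrite [X in is_derive _ _ X _](_ : _ =
  (fun y => complex.Re (F y)) * (fun y => complex.Im (G y)) +
  (fun y => complex.Im (F y)) * (fun y => complex.Re (G y))); last first.
  by apply/funext => y; rewrite ImM.
apply: is_derive_eq (is_deriveD (is_deriveM dF dG') (is_deriveM dF' dG)) _.
rewrite ImD !ImM /GRing.scale/=.
move: (F x) (G x) l k {dF dF' dG dG'} => [a b] [c d] [e f] [g h] /=; ring.
Qed.

Lemma is_cderiveX (R : realType) (V : normedModType R) (x v : V)
    (F : V -> R[i]) (l : R[i]) (m : nat) :
  is_cderive x v F l ->
  is_cderive x v (fun y => F y ^+ m) (m%:R * F x ^+ m.-1 * l).
Proof.
move=> dF; elim: m => [|m IH].
  by rewrite !mul0r; exact: is_cderive_cst.
have -> : m.+1%:R * F x ^+ m.+1.-1 * l =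
    l * F x ^+ m + F x * (m%:R * F x ^+ m.-1 * l).
  case: m {IH} => [|m] /=; first by ring.
  by rewrite exprS -[m.+2%:R]natr1; ring.
rewrite [X in is_cderive _ _ X](_ : _ = (fun y => F y * F y ^+ m)).
  exact: is_cderiveM.
by apply/funext => y; rewrite exprS.
Qed.

Lemma is_cderive_realC (R : realType) (V : normedModType R) (x v : V)
    (f : V -> R) (l : R) :
  is_derive x v f l -> is_cderive x v (fun y => (f y)%:C%C) l%:C%C.
Proof. by move=> df; split => //; exact: is_derive_cst. Qed.

Lemma mpoly_ring_ind (n : nat) (A : comNzRingType) (P : mpoly n A -> Prop) :
  (forall c, P (mpolyC n c)) -> (forall i, P (mpolyX A (mnm1 i))) ->
  (forall p q, P p -> P q -> P (p + q)) ->
  (forall p q, P p -> P q -> P (p * q)) -> forall p, P p.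
Proof.
move=> PC PX PD PM p; rewrite (mpolyE p).
elim/big_rec: _ => [|m q _ Pq]; first by rewrite -(mpolyC0 n).
apply: (PD) => //; rewrite -mul_mpolyC; apply: (PM) => //.
rewrite mpolyXE_id; elim/big_rec: _ => [|i r _ Pr].
  by rewrite -mpolyC1.
apply: (PM) => //; elim: (m i) => [|k IH]; first by rewrite expr0 -mpolyC1.
by rewrite exprS; exact: PM.
Qed.

(** Chain rule, with inner functions on any normed space so that it serves for coordinates, for rays
    and for great circles. *)
Lemma is_cderive_meval (R : realType) (V : normedModType R) (x v : V) (n : nat)
    (g : V -> 'I_n -> R[i]) (l : 'I_n -> R[i]) (p : mpoly n R[i]) :
  (forall k, is_cderive x v (g ^~ k) (l k)) ->
  is_cderive x v (fun y => meval (g y) p)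
    (\sum_k l k * meval (g x) (mderiv k p)).
Proof.
move=> dg; elim/mpoly_ring_ind: p => [c|i|p q dp dq|p q dp dq].
- rewrite big1 => [|k _]; last by rewrite mderivC meval0 mulr0.
  rewrite [X in is_cderive _ _ X](_ : _ = fun=> c); first exact: is_cderive_cst.
  by apply/funext => y; rewrite mevalC.
- rewrite (bigD1 i) //= big1 => [|k ki].
    rewrite mderivX mnm1E eqxx scale1r (_ : mnm_sub _ _ = mnm0)
      ?mpolyX0 ?meval1 ?mulr1 ?addr0; last first.
      by apply/mnmP => k; rewrite mnmBE mnm0E subnn.
    rewrite [X in is_cderive _ _ X](_ : _ = g ^~ i) //.
    by apply/funext => y; rewrite mevalXU.
  by rewrite mderivX mnm1E eq_sym (negbTE ki) scale0r meval0 mulr0.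
- rewrite (eq_bigr (fun k => l k * meval (g x) (mderiv k p) +
     l k * meval (g x) (mderiv k q))) => [|k _]; last first.
    by rewrite mderivD mevalD mulrDr.
  rewrite big_split /= [X in is_cderive _ _ X](_ : _ = fun y => meval (g y) p + meval (g y) q).
    exact: (is_cderiveD dp dq).
  by apply/funext => y; rewrite mevalD.
- rewrite (eq_bigr (fun k => l k * meval (g x) (mderiv k p) * meval (g x) q +
     meval (g x) p * (l k * meval (g x) (mderiv k q)))) => [|k _]; last first.
    by rewrite mderivM mevalD !mevalM mulrDr mulrA [l k * (_ * _)]mulrCA.
  rewrite big_split /= -mulr_suml -mulr_sumr.
  rewrite [X in is_cderive _ _ X](_ : _ = fun y => meval (g y) p * meval (g y) q).
    exact: (is_cderiveM dp dq).
  by apply/funext => y; rewrite mevalM.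
Qed.

(** * Riesz' interpolation formula *)

Definition expi (R : realType) (t : R) : R[i] := (cos t +i* sin t)%C.

Lemma expiD (R : realType) (s t : R) : expi (s + t) = expi s * expi t.
Proof. by rewrite /expi cosD sinD; congr (_ +i* _)%C; rewrite addrC. Qed.

Lemma expi0 (R : realType) : expi (0 : R) = 1.
Proof. by rewrite /expi cos0 sin0. Qed.

Lemma expiMn (R : realType) (t : R) (k : nat) : expi (t *+ k) = expi t ^+ k.
Proof.
by elim: k => [|k IH]; rewrite ?expi0 // mulrS expiD IH exprS.
Qed.

Lemma normc_expi (R : realType) (t : R) : normc (expi t) = 1.
Proof. by rewrite /= cos2Dsin2 sqrtr1. Qed.

Lemma expi_neq0 (R : realType) (t : R) : expi t != 0.
Proof.
by apply/eqP => /(congr1 (@normc R)); rewrite normc_expi Normc.normc0 => /eqP; rewrite oner_eq0.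
Qed.

Lemma expiN (R : realType) (t : R) : expi (- t) = (expi t)^-1.
Proof.
by apply: (mulIf (expi_neq0 t)); rewrite -expiD addNr expi0 mulVf ?expi_neq0.
Qed.

Lemma expi_pi (R : realType) : expi (pi : R) = -1.
Proof. by rewrite /expi cospi sinpi; apply/eqP; rewrite eq_complex /= oppr0 !eqxx. Qed.

(** By the double angle formula, [cos t = 1] forces [sin (t / 2) = 0], impossible for
    [0 < t / 2 < pi]. *)
Lemma expi_neq1 (R : realType) (t : R) : 0 < `|t| < pi *+ 2 -> expi t != 1.
Proof.
wlog t0 : t / 0 < t => [H tb|].
  have [t0|t0|t0] := ltgtP 0 t; first exact: H.
    apply/eqP => t1; suff /eqP : expi (- t) != 1 by rewrite expiN t1 invr1.
    by apply: H; rewrite ?normrN ?oppr_gt0.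
  by move: tb; rewrite -t0 normr0 ltxx.
rewrite gtr0_norm // => /andP[_ t2]; apply/eqP => -[/eqP + _].
rewrite [t]splitr cosD -!expr2 cos2sin2 => /eqP H.
have s0 : 0 < sin (t / 2) by apply: sin_gt0_pi; lra.
by have := exprn_gt0 2 s0; lra.
Qed.

Lemma is_cderive_expi (R : realType) (t : R) :
  is_cderive t 1 (@expi R) ((0 +i* 1)%C * expi t).
Proof.
rewrite /expi; split => /=; rewrite !mul0r mul1r ?sub0r ?add0r.
  exact: is_derive_cos.
exact: is_derive_sin.
Qed.

Lemma is_cderive_expiN (R : realType) (t : R) :
  is_cderive t 1 (fun s : R => expi (- s)) (- (0 +i* 1)%C * expi (- t)).
Proof.
rewrite (_ : (fun s : R => _) = fun s : R => (cos s +i* - sin s)%C); last first.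
  by apply/funext => s; rewrite /expi cosN sinN.
rewrite /expi cosN sinN; split => /=.
  by rewrite oppr0 mul0r sub0r mulN1r opprK; exact: is_derive_cos.
rewrite oppr0 mul0r add0r mulN1r.
exact: (is_deriveN (is_derive_sin t)).
Qed.

Lemma is_cderive_horner (R : realType) (V : normedModType R) (x v : V)
    (g : V -> R[i]) (l : R[i]) (p : {poly R[i]}) :
  is_cderive x v g l ->
  is_cderive x v (fun y => p.[g y]) (p^`().[g x] * l).
Proof.
move=> dg; elim/poly_ind: p => [|p c IH].
  rewrite deriv0 horner0 mul0r.
  rewrite [X in is_cderive _ _ X](_ : _ = fun=> 0); first exact: is_cderive_cst.
  by apply/funext => y; rewrite horner0.
rewrite [X in is_cderive _ _ X](_ : _ = fun y => p.[g y] * g y + c); last first.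
  by apply/funext => y; rewrite !hornerE.
have := is_cderiveD (is_cderiveM IH dg) (is_cderive_cst x v c).
by congr is_cderive; rewrite derivD derivM derivX derivC !hornerE; ring.
Qed.

(** * Nodes and weights of Riesz' formula *)

Section RieszNodes.
Variables (R : realType) (N : nat).
Hypothesis N0 : (0 < N)%N.

Let M := (2 * N)%N.
Let C := R[i].

Definition riesz_angle (r : nat) : R := (pi / M%:R) *+ (2 * r + 1).

Definition riesz_coef (r : nat) : R[i] :=
  M%:R^-1 * \sum_(k < M) (k%:R - N%:R) * (expi (riesz_angle r))^-1 ^+ k.

Let M0 : (0 < M)%N. Proof. by rewrite muln_gt0. Qed.
Let MR : (M%:R : R) != 0. Proof. by rewrite pnatr_eq0 -lt0n. Qed.
Let MC : (M%:R : C) != 0. Proof. by rewrite pnatr_eq0 -lt0n. Qed.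

Lemma expi_riesz_angle r : expi (riesz_angle r) ^+ M = -1.
Proof.
rewrite -expiMn /riesz_angle -mulrnA mulnC mulrnA -[_ *+ M]mulr_natr.
rewrite divfK // expiMn expi_pi.
by rewrite exprD exprM sqrrN !expr1n mul1r.
Qed.

(** Orthogonality of the powers on the nodes: the sum is geometric with ratio [expi (x *+ 2)], an
    [M]-th root of unity that is 1 only for [k = l], since [|l - k| < M]. *)
Lemma sum_expi_riesz_angle (k l : nat) : (k < M)%N -> (l < M)%N ->
  \sum_(r < M) expi (riesz_angle r) ^+ l * (expi (riesz_angle r))^-1 ^+ k =
  (M * (k == l))%:R.
Proof.
move=> kM lM.
(* Half the argument of the ratio: as the nodes are odd multiples of [pi / M], the term of index [r]
   has argument [(2 * r + 1) * x]. *)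
pose x : R := pi / M%:R * (l%:R - k%:R).
have wE r : expi (riesz_angle r) ^+ l * (expi (riesz_angle r))^-1 ^+ k =
    expi x * (expi (x *+ 2)) ^+ r.
  rewrite -expiN -!expiMn -!expiD /riesz_angle; congr expi.
  rewrite /x; move: (pi / M%:R) => y.
  ring.
under eq_bigr do rewrite wE.
rewrite -mulr_sumr; have [kl|kl] := eqVneq k l.
  rewrite /x kl subrr mulr0 mul0rn expi0 mul1r.
  by under eq_bigr do rewrite expr1n; rewrite sumr_const card_ord muln1.
rewrite muln0.
have xM : expi (x *+ 2) ^+ M = 1.
  rewrite -expiMn (_ : _ *+ _ = pi *+ 2 * l%:R - pi *+ 2 * k%:R); last first.
    by rewrite /x; move: pi MR => y yM; field.
  have e2 j : expi (pi *+ 2 * j%:R) = 1 :> C.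
    by rewrite mulr_natr expiMn expiMn expi_pi sqrrN !expr1n.
  by rewrite expiD expiN !e2 invr1 mulr1.
have x1 : expi (x *+ 2) != 1.
  apply: expi_neq1.
  have d0 : 0 < `|l%:R - k%:R| :> R by rewrite normr_gt0 subr_eq0 eqr_nat eq_sym.
  have dM : `|l%:R - k%:R| < M%:R :> R.
    rewrite ltr_norml; apply/andP; split.
      by rewrite ltrBrDr addrC (lt_le_trans (y := 0)) ?subr_lt0 ?ltr_nat.
    by rewrite ltrBlDr (lt_le_trans (y := M%:R)) ?ltr_nat ?lerDl.
  have pM : 0 < pi / M%:R :> R by rewrite divr_gt0 ?pi_gt0 ?ltr0n.
  rewrite normrMn /x normrM (gtr0_norm pM) pmulrn_lgt0 // mulr_gt0 //=.
  by rewrite ltrMn2r /= mulrAC ltr_pdivrMr ?ltr0n // ltr_pM2l ?pi_gt0.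
have := subrX1 (expi (x *+ 2)) M; rewrite xM subrr => /esym/eqP.
by rewrite mulf_eq0 subr_eq0 (negbTE x1) /= => /eqP ->; rewrite mulr0.
Qed.

Lemma sum_riesz_coef (l : nat) : (l <= M)%N ->
  \sum_(r < M) riesz_coef r * expi (riesz_angle r) ^+ l = l%:R - N%:R.
Proof.
(* Orthogonality reaches only [l < M]. For [l = M] every [w ^+ M] is -1, so the sum is minus the one
   for [l = 0], that is [N = M - N]. *)
wlog lM : l / (l < M)%N => [H|_].
  rewrite leq_eqVlt => /orP[/eqP->|lM]; last by apply: H => //; exact: ltnW.
  under eq_bigr do rewrite expi_riesz_angle mulrN1.
  rewrite sumrN; have := H 0%N M0 (leq0n _).
  under eq_bigr do rewrite expr0 mulr1.
  by move=> ->; rewrite /M natrM; ring.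
rewrite (eq_bigr (fun r : 'I_M => \sum_(k < M) M%:R^-1 * (k%:R - N%:R) *
  (expi (riesz_angle r) ^+ l * (expi (riesz_angle r))^-1 ^+ k))); last first.
  by move=> r _; rewrite /riesz_coef mulr_sumr mulr_suml; apply: eq_bigr => k _; ring.
rewrite exchange_big /= (bigD1 (Ordinal lM)) //= [X in _ + X]big1 => [|k kl].
  rewrite -mulr_sumr sum_expi_riesz_angle // eqxx muln1 addr0 mulrAC.
  by rewrite mulVf // mul1r.
rewrite -mulr_sumr sum_expi_riesz_angle // (negbTE (_ : nat_of_ord k != l)) //.
by rewrite muln0 mulr0.
Qed.

Lemma riesz_coef_le0 (r : nat) : riesz_coef r <= 0.
Proof.
rewrite /riesz_coef.
set v := (expi (riesz_angle r))^-1.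
have vM : v ^+ M = -1 by rewrite /v exprVn expi_riesz_angle invrN1.
have v1 : 1 - v != 0.
  apply/eqP => /subr0_eq v1; move: vM; rewrite -v1 expr1n => /eqP.
  by rewrite -subr_eq0 opprK -mulr2n pnatr_eq0.
(* Closed form of the sum, cleared of the denominator [(1 - x) ^+ 2]. At [v], where [v ^+ M = -1]
   and [M = 2 * N], its right-hand side collapses to [2 * v]. *)
have S (x : R[i]) (m : nat) :
    (1 - x) ^+ 2 * (\sum_(k < m) (k%:R - N%:R) * x ^+ k) =
    x - N%:R * (1 - x) + x ^+ m * (N%:R * (1 - x) - x - m%:R * (1 - x)).
  elim: m => [|m IH]; first by rewrite big_ord0 expr0; ring.
  by rewrite big_ord_recr /= mulrDr IH [x ^+ m.+1]exprS; ring.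
have := S v M; rewrite vM {S}; set S := \sum_(k < M) _ => SE.
have v0 : v != 0 by rewrite invr_eq0 expi_neq0.
have {}SE : S * ((1 - v) ^+ 2 / v) = 2.
  rewrite mulrA [S * _]mulrC SE /M natrM; field => //.
(* As [v] is on the unit circle, [v + 1 / v - 2] is real; it is negative because [v] is not 1. *)
have vR : (1 - v) ^+ 2 / v = (2 * (cos (riesz_angle r) - 1))%:C%C.
  have -> : (1 - v) ^+ 2 / v = v^-1 + v - 2 by field.
  rewrite /v invrK -expiN /expi cosN sinN.
  by apply/eqP; rewrite eq_complex /=; apply/andP; split; apply/eqP; ring.
have c1 : cos (riesz_angle r) - 1 < 0.
  rewrite lt_neqAle subr_le0 cos_le1 andbT subr_eq0; apply: contra v1 => /eqP c1.
  rewrite /v /expi.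
  have /eqP := cos2Dsin2 (riesz_angle r); rewrite c1 expr1n -subr_eq0 addrAC subrr add0r.
  by rewrite expf_eq0 /= => /eqP ->; rewrite subr_eq0 eq_sym invr_eq1.
rewrite pmulr_rle0 ?invr_gt0 ?ltr0n //.
have : S * (2 * (cos (riesz_angle r) - 1))%:C%C = 2 by rewrite -vR.
have c2 : (2 * (cos (riesz_angle r) - 1))%:C%C < 0 :> R[i].
  by rewrite -[0]/(0%:C%C) ltcR pmulr_rlt0.
move=> S2; rewrite -(nmulr_lge0 _ c2) S2; exact: ler0n.
Qed.

Lemma sum_normc_riesz_coef : \sum_(r < M) normc (riesz_coef r) = N%:R.
Proof.
apply: complexI; rewrite rmorph_sum /= rmorph_nat.
rewrite (eq_bigr (fun r : 'I_M => - riesz_coef r)); last first.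
  by move=> r _; rewrite -normcE ler0_norm // riesz_coef_le0.
rewrite sumrN; have := sum_riesz_coef (leq0n M).
under eq_bigr do rewrite expr0 mulr1.
by move=> ->; rewrite sub0r opprK.
Qed.

(** By linearity it is enough to treat [X^k], where [sum_riesz_coef] gives [(k - N) u^k]. Up to the
    factor [i u^-N], the right-hand side is the derivative in [t] of [u^-N p(u)] at
    [u = exp(it)]. *)
Lemma riesz_horner (p : {poly R[i]}) (u : R[i]) : (size p <= M.+1)%N ->
  \sum_(r < M) riesz_coef r * p.[u * expi (riesz_angle r)] =
  u * p^`().[u] - N%:R * p.[u].
Proof.
move=> ps.
have pE : p = \sum_(k < M.+1) p`_k *: 'X^k.
  apply/polyP => i; rewrite coef_sum.
  rewrite (eq_bigr (fun k : 'I_M.+1 => p`_k * (i == k)%:R)) => [|k _]; last first.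
    by rewrite coefZ coefXn.
  have [iM|iM] := ltnP i M.+1.
    rewrite (bigD1 (Ordinal iM)) //= eqxx mulr1 big1 ?addr0 // => k ki.
    by rewrite (_ : (i == k) = false) ?mulr0 //; apply/negbTE; rewrite eq_sym.
  rewrite nth_default ?(leq_trans ps) // big1 // => k _.
  rewrite (_ : (i == k) = false) ?mulr0 //; apply/negbTE.
  by rewrite gtn_eqF // (leq_trans (ltn_ord k)).
rewrite (eq_bigr (fun r : 'I_M => \sum_(k < M.+1) p`_k * u ^+ k *
    (riesz_coef r * expi (riesz_angle r) ^+ k))) => [|r _]; last first.
  rewrite {1}pE horner_sum mulr_sumr; apply: eq_bigr => k _.
  by rewrite hornerZ hornerXn exprMn; ring.
rewrite exchange_big /= {2 3}pE linear_sum /= !horner_sum !mulr_sumr -sumrB.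
apply: eq_bigr => k _; rewrite -mulr_sumr sum_riesz_coef; last by rewrite -ltnS.
rewrite derivZ derivXn !hornerZ hornerMn !hornerXn -mulr_natr.
case: (nat_of_ord k) => [|j] /=; first by rewrite expr0; ring.
by rewrite exprS; ring.
Qed.

End RieszNodes.

(** A trigonometric polynomial of degree [N] is written [exp(-iNs) p(exp(is))] with [p] of degree at
    most [2 * N]. Weights and angles are chosen before [p] and [t], so that differentiation is one
    fixed combination of translations. *)
Lemma riesz_trig (R : realType) (N : nat) :
  exists (a : 'I_(2 * N) -> R[i]) (th : 'I_(2 * N) -> R),
    \sum_r normc (a r) = N%:R /\
    forall (p : {poly R[i]}) (t : R), (size p <= (2 * N).+1)%N ->
      let f s := expi (- s) ^+ N * p.[expi s] in
      is_cderive t 1 f (\sum_r a r * f (t + th r)).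
Proof.
have [->|N0] := posnP N.
  exists (fun=> 0), (fun=> 0); split; first by rewrite big_ord0.
  move=> p t /size1_polyC -> f; rewrite big_ord0.
  rewrite (_ : f = fun=> p`_0); first exact: is_cderive_cst.
  by apply/funext => s; rewrite /f expr0 mul1r hornerC.
(* The factor [expi (riesz_angle R N r) ^+ N] offsets the shift of [expi (- s) ^+ N] from [t] to
   [t + th r]; the factor [i] comes from the derivative of [expi]. *)
exists (fun r => (0 +i* 1)%C * riesz_coef R N r * expi (riesz_angle R N r) ^+ N).
exists (fun r => riesz_angle R N r); split.
  rewrite -(sum_normc_riesz_coef R N0); apply: eq_bigr => r _.
  rewrite !Normc.normcM (_ : normc (_ ^+ N) = 1).
    by rewrite mulr1 (_ : normc (0 +i* 1)%C = 1) ?mul1r //= expr0n expr1n add0r sqrtr1.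
  by rewrite -expiMn normc_expi.
move=> p t ps f.
have := is_cderiveM (is_cderiveX N (is_cderive_expiN t))
  (is_cderive_horner p (is_cderive_expi t)).
congr is_cderive.
rewrite (eq_bigr (fun r : 'I_(2 * N) => (0 +i* 1)%C * expi (- t) ^+ N *
  (riesz_coef R N r * p.[expi t * expi (riesz_angle R N r)]))); last first.
  move=> r _; rewrite /f expiD opprD expiD exprMn (expiN (riesz_angle _ _ _)).
  set w := expi (riesz_angle R N r); have w0 : w != 0 by exact: expi_neq0.
  by rewrite exprVn; field; rewrite expf_neq0.
rewrite -mulr_sumr riesz_horner //.
case: N N0 {ps f} => // k _ /=; rewrite [_ ^+ k.+1]exprS; ring.
Qed.

(** Each coordinate, affine in [cos s] and [sin s], becomes a polynomial of degree at most 2 in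
    [expi s] once multiplied by [expi s]; homogeneity makes these factors amount to exactly
    [expi s ^+ N]. *)
Lemma homog_meval_poly (R : realType) (n N : nat) (q : mpoly n R[i])
    (A B D : 'I_n -> R[i]) : q \is ishomog1 N mdeg ->
  exists2 p : {poly R[i]}, (size p <= (2 * N).+1)%N &
    forall s : R, meval (fun k => A k + (cos s)%:C%C * B k + (sin s)%:C%C * D k) q =
      expi (- s) ^+ N * p.[expi s].
Proof.
move=> /dhomogP hq.
(* From [cos s = (w^2 + 1) / (2 w)] and [sin s = (w^2 - 1) / (2 i w)] with [w = expi s]. *)
pose L k : {poly R[i]} := A k *: 'X + (B k / 2) *: ('X^2 + 1) +
  (D k / (2 * (0 +i* 1)%C)) *: ('X^2 - 1).
have LE k s : (L k).[expi s] = expi s *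
    (A k + (cos s)%:C%C * B k + (sin s)%:C%C * D k).
  rewrite !hornerE.
  have i0 : (0 +i* 1)%C != 0 :> R[i] by rewrite eq_complex /= oner_eq0 andbF.
  have i2 : (0 +i* 1)%C ^+ 2 = -1 :> R[i] by exact: sqr_i.
  have eE : expi s = (cos s)%:C%C + (0 +i* 1)%C * (sin s)%:C%C.
    by rewrite [LHS]complexE.
  have cs : (cos s)%:C%C ^+ 2 + (sin s)%:C%C ^+ 2 = 1 :> R[i].
    by rewrite -!rmorphXn -rmorphD /= cos2Dsin2.
  rewrite eE; move: (cos s)%:C%C (sin s)%:C%C (0 +i* 1)%C i0 i2 cs {eE} => c d i i0 i2 cs.
  have -> : (c + i * d) ^+ 2 + 1 = 2 * c * (c + i * d).
    by rewrite -[X in _ + X = _]cs sqrrD exprMn i2; ring.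
  have -> : (c + i * d) ^+ 2 - 1 = 2 * i * d * (c + i * d).
    rewrite -[X in _ - X = _]cs sqrrD exprMn i2.
    have -> : 2 * i * d * (c + i * d) = 2 * i * c * d + 2 * i ^+ 2 * d ^+ 2 by ring.
    by rewrite i2; ring.
  by field.
have sM (p1 p2 : {poly R[i]}) a b : (size p1 <= (2 * a).+1)%N ->
    (size p2 <= (2 * b).+1)%N -> (size (p1 * p2)%R <= (2 * (a + b)).+1)%N.
  move=> s1 s2; rewrite (leq_trans (size_polyMleq _ _)) //; lia.
have sL k : (size (L k) <= 3)%N.
  rewrite (leq_trans (size_polyD _ _)) // geq_max; apply/andP; split; last first.
    by rewrite (leq_trans (size_scale_leq _ _)) // size_XnsubC.
  rewrite (leq_trans (size_polyD _ _)) // geq_max; apply/andP; split.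
    by rewrite (leq_trans (size_scale_leq _ _)) // size_polyX.
  by rewrite (leq_trans (size_scale_leq _ _)) // size_XnaddC.
have sP (m : multinom n) : (size (\prod_k L k ^+ m k)%R <= (2 * mdeg m).+1)%N.
  rewrite mdegE; elim/big_rec2: _ => [|k d P _ IH]; first by rewrite size_poly1.
  apply: (sM) => //; elim: (m k) => [|j IHj]; first by rewrite expr0 size_poly1.
  by rewrite exprS -[j.+1]add1n; apply: sM.
exists (\sum_(m <- msupp q) mcoeff m q *: \prod_k L k ^+ m k).
  rewrite (leq_trans (size_sum _ _ _)) //; apply/bigmax_leqP_seq => m mq _.
  by rewrite (leq_trans (size_scale_leq _ _)) // -(hq _ mq).
move=> s; rewrite mevalE horner_sum mulr_sumr; apply: eq_big_seq => m mq.
rewrite hornerZ mulrCA; congr (_ * _).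
rewrite horner_prod; under [in RHS]eq_bigr do rewrite horner_exp LE exprMn.
rewrite big_split /= mulrA prodrXr -mdegE hq // -exprMn -expiD addNr expi0.
by rewrite expr1n mul1r.
Qed.

Lemma riesz_meval (R : realType) (N : nat) :
  exists (a : 'I_(2 * N) -> R[i]) (th : 'I_(2 * N) -> R),
    \sum_r normc (a r) = N%:R /\
    forall (n : nat) (q : mpoly n R[i]) (A B D : 'I_n -> R[i]) (t : R),
      q \is ishomog1 N mdeg ->
      let f s := meval (fun k => A k + (cos s)%:C%C * B k + (sin s)%:C%C * D k) q in
      is_cderive t 1 f (\sum_r a r * f (t + th r)).
Proof.
have [a [th [aN H]]] := riesz_trig R N; exists a, th; split => //.
move=> n q A B D t /(homog_meval_poly A B D)[p ps pE] f.
have fE : f = fun s => expi (- s) ^+ N * p.[expi s] by apply/funext => s; exact: pE.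
by rewrite fE; exact: H.
Qed.

(** * Homogeneous polynomials on the sphere *)

Definition rmeval (R : realType) (n : nat) (p : mpoly n R[i]) (x : 'rV[R]_n) :
  R[i] := meval (fun i => (x 0 i)%:C%C) p.

Lemma sphereE (R : realType) (n : nat) (x : 'rV[R]_n) :
  sphere x <-> \sum_i x 0 i ^+ 2 = 1.
Proof.
rewrite /sphere /enorm /=; split=> [x1|->]; last exact: sqrtr1.
have s0 : 0 <= \sum_i x 0 i ^+ 2 by apply: sumr_ge0 => i _; exact: sqr_ge0.
by rewrite -(sqr_sqrtr s0) x1 expr1n.
Qed.

Lemma is_derive_coord (R : realType) (n : nat) (x v : 'rV[R]_n) (k : 'I_n) :
  is_derive x v (fun y : 'rV[R]_n => y 0 k) (v 0 k).
Proof.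
have H : (fun h : R => h^-1 *: (((fun y : 'rV[R]_n => y 0 k) \o shift x) (h *: v)
    - x 0 k)) @ 0^' --> (v 0 k : R).
  apply: cvg_near_cst; near=> h; have h0 : h != 0 by near: h; exact: nbhs_dnbhs_neq.
  by rewrite /= !mxE addrK /GRing.scale /= mulrA mulVf // mul1r.
by split; [apply: cvgP H | apply/cvg_lim/H].
Unshelve. all: by end_near. Qed.

Lemma is_cderive_rmeval (R : realType) (n : nat) (i : 'I_n)
    (p : mpoly n R[i]) (x : 'rV[R]_n) :
  is_cderive x (delta_mx 0 i) (rmeval p) (rmeval (mderiv i p) x).
Proof.
apply: (is_cderive_eq (is_cderive_meval p (fun k => is_cderive_realC
  (is_derive_coord x (delta_mx 0 i) k)))) => //.
rewrite (bigD1 i) //= big1 => [|k ki]; first by rewrite mxE !eqxx mul1r addr0.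
by rewrite mxE (negbTE ki) andbF mul0r.
Qed.

Lemma pderiv_rmeval (R : realType) (n : nat) (i : 'I_n) (p : mpoly n R[i]) :
  pderiv i (rmeval p) = rmeval (mderiv i p).
Proof.
by apply/funext => x; apply: is_cderive_pderiv; exact: is_cderive_rmeval.
Qed.

Lemma mderiv_homog0 (A : comNzRingType) (n : nat) (i : 'I_n) (p : mpoly n A) :
  p \is ishomog1 0 mdeg -> mderiv i p = 0.
Proof.
move=> /dhomogP hp; rewrite [p in mderiv _ p]mpolyE linear_sum /= big_seq.
apply: big1 => m /hp /eqP; rewrite mdeg_eq0 => /eqP ->.
by rewrite mderivZ mderivX mnm0E scale0r scaler0.
Qed.

Lemma mderiv_homog (A : comNzRingType) (n d : nat) (i : 'I_n) (p : mpoly n A) :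
  p \is ishomog1 d mdeg -> mderiv i p \is ishomog1 d.-1 mdeg.
Proof.
move=> /dhomogP hp; rewrite [p in mderiv _ p]mpolyE linear_sum /= big_seq.
apply: rpred_sum => m /hp md; rewrite mderivZ mderivX; apply: dhomogZ.
have [->|mi] := posnP (m i); first by rewrite scale0r; exact: dhomog0.
apply: dhomogZ; rewrite dhomogX; apply/eqP.
have im : lem (mnm1 i) m by rewrite lep1mP -lt0n.
have <- : mdeg m = d by exact: md.
by rewrite -[in RHS](submK im) mdegD mdeg1 addn1.
Qed.

Lemma rmevalZ (R : realType) (n d : nat) (p : mpoly n R[i]) (c : R)
    (x : 'rV[R]_n) :
  p \is ishomog1 d mdeg -> rmeval p (c *: x) = c%:C%C ^+ d * rmeval p x.
Proof.
move=> /dhomogP hp; rewrite /rmeval !mevalE mulr_sumr; apply: eq_big_seq => m mp.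
rewrite mulrCA; congr (_ * _).
under eq_bigr do rewrite mxE rmorphM exprMn.
by rewrite big_split /= prodrXr -mdegE hp.
Qed.

(** Differentiate [p (t x) = t^d p (x)] at [t = 1] in two ways. *)
Lemma euler_homog (R : realType) (n d : nat) (p : mpoly n R[i])
    (x : 'rV[R]_n) : p \is ishomog1 d mdeg ->
  \sum_k (x 0 k)%:C%C * rmeval (mderiv k p) x = d%:R * rmeval p x.
Proof.
move=> hp.
have d1 : is_cderive (1 : R) 1 (fun t : R => t%:C%C) 1.
  exact: (is_cderive_realC (is_derive_id (1 : R) 1)).
have := is_cderiveM (is_cderiveX d d1) (is_cderive_cst (1 : R) 1 (rmeval p x)).
rewrite !expr1n !mulr1 mulr0 addr0; apply: is_cderive_unique.
rewrite (_ : (fun y : R => _) = fun t : R => rmeval p (t *: x)); last first.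
  by apply/funext => t; rewrite (rmevalZ _ _ hp).
apply: is_cderive_eq (is_cderive_meval p (fun k => is_cderiveM d1
  (is_cderive_cst (1 : R) 1 (x 0 k)%:C%C))) _ _ => [t|].
  by apply: meval_eq => k; rewrite mxE rmorphM.
apply: eq_bigr => k _; rewrite mulr0 addr0 mul1r; congr (_ * _).
by apply: meval_eq => l; rewrite mul1r.
Qed.

(** * First derivatives of a homogeneous polynomial on the sphere *)

Section SphereBounds.
Variables (R : realType) (n d : nat) (p : mpoly n R[i]) (K : R).
Hypothesis hp : p \is ishomog1 d mdeg.
Hypothesis pK : forall x, sphere x -> normc (rmeval p x) <= K.

(** The sum is the derivative at [s = 0] of [p] along [cos s *: x + sin s *: v], a great circle by
    orthogonality; every translate in Riesz' formula is thus bounded by [K], and the weights have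
    mass [d]. *)
Lemma tangential_deriv_le (x v : 'rV[R]_n) : sphere x -> sphere v ->
  \sum_k x 0 k * v 0 k = 0 ->
  normc (\sum_k (v 0 k)%:C%C * rmeval (mderiv k p) x) <= d%:R * K.
Proof.
move=> /sphereE x1 /sphereE v1 xv.
have [a [th [aE H]]] := riesz_meval R d.
pose f s := meval (fun k => 0 + (cos s)%:C%C * (x 0 k)%:C%C +
  (sin s)%:C%C * (v 0 k)%:C%C) p.
have fE s : f s = rmeval p (cos s *: x + sin s *: v).
  by apply: meval_eq => k; rewrite !mxE add0r rmorphD !rmorphM.
have fK s : normc (f s) <= K.
  rewrite fE; apply: pK; apply/sphereE.
  rewrite (eq_bigr (fun k => cos s ^+ 2 * x 0 k ^+ 2 +
    2 * cos s * sin s * (x 0 k * v 0 k) + sin s ^+ 2 * v 0 k ^+ 2)).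
    by rewrite !big_split /= -!mulr_sumr x1 v1 xv mulr0 addr0 !mulr1 cos2Dsin2.
  by move=> k _; rewrite !mxE; ring.
have dc : is_cderive (0 : R) 1 (fun s => (cos s)%:C%C) 0.
  have := is_cderive_realC (is_derive_cos (0 : R)).
  by rewrite sin0 oppr0.
have ds : is_cderive (0 : R) 1 (fun s => (sin s)%:C%C) 1.
  have := is_cderive_realC (is_derive_sin (0 : R)).
  by rewrite cos0.
have df : is_cderive (0 : R) 1 f (\sum_k (v 0 k)%:C%C * rmeval (mderiv k p) x).
  have dg k := is_cderiveD
    (is_cderiveD (is_cderive_cst (0 : R) 1 0)
       (is_cderiveM dc (is_cderive_cst (0 : R) 1 (x 0 k)%:C%C)))
    (is_cderiveM ds (is_cderive_cst (0 : R) 1 (v 0 k)%:C%C)).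
  apply: (is_cderive_eq (is_cderive_meval p dg)) => [s|]; first by [].
  apply: eq_bigr => k _.
  rewrite !mulr0 mul0r mul1r !addr0 add0r; congr (_ * _).
  by apply: meval_eq => l; rewrite cos0 sin0 mul1r mul0r addr0 add0r.
rewrite (is_cderive_unique df (H n p (fun=> 0) (fun k => (x 0 k)%:C%C)
  (fun k => (v 0 k)%:C%C) 0 hp)).
rewrite (le_trans (normc_sum _ _ _)) // -aE mulr_suml ler_sum // => r _.
by rewrite Normc.normcM ler_wpM2l ?normc_ge0 ?fK.
Qed.

(** The radial term is kept as an equality, because [partial_deriv_le] bounds it while
    [shifted_deriv_le] first cancels most of it. *)
Lemma partial_deriv_split (x : 'rV[R]_n) (i : 'I_n) : sphere x ->
  exists2 T : R[i],
    rmeval (mderiv i p) x = (x 0 i)%:C%C * (d%:R * rmeval p x) + T &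
    normc T <= Num.sqrt (1 - x 0 i ^+ 2) * (d%:R * K).
Proof.
move=> xS; have x1 := (sphereE x).1 xS.
pose v : 'rV[R]_n := delta_mx 0 i - x 0 i *: x.
have sumE (F : 'I_n -> R) : \sum_k (delta_mx 0 i : 'rV[R]_n) 0 k * F k = F i.
  rewrite (bigD1 i) //= big1 => [|k ki]; first by rewrite mxE !eqxx mul1r addr0.
  by rewrite mxE (negbTE ki) andbF mul0r.
have v2 : \sum_k v 0 k ^+ 2 = 1 - x 0 i ^+ 2.
  rewrite (eq_bigr (fun k => (delta_mx 0 i : 'rV[R]_n) 0 k *
    ((delta_mx 0 i : 'rV[R]_n) 0 k - 2 * x 0 i * x 0 k) +
    x 0 i ^+ 2 * x 0 k ^+ 2)).
    by rewrite big_split /= sumE -mulr_sumr x1 mxE !eqxx /=; ring.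
  by move=> k _; rewrite /v !mxE; move: (_%:R) => e; ring.
have xv : \sum_k x 0 k * v 0 k = 0.
  rewrite (eq_bigr (fun k => (delta_mx 0 i : 'rV[R]_n) 0 k * x 0 k -
    x 0 i * x 0 k ^+ 2)).
    by rewrite sumrB sumE -mulr_sumr x1 mulr1 subrr.
  by move=> k _; rewrite /v !mxE; move: (_%:R) => e; ring.
exists (\sum_k (v 0 k)%:C%C * rmeval (mderiv k p) x).
  rewrite -(euler_homog x hp) mulr_sumr -big_split /= (bigD1 i) //= big1.
    by rewrite !mxE !eqxx rmorphB rmorphM rmorph1; ring.
  by move=> k ki; rewrite !mxE (negbTE ki) andbF sub0r rmorphN rmorphM; ring.
set s := Num.sqrt _; have s2 : s ^+ 2 = 1 - x 0 i ^+ 2.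
  by rewrite sqr_sqrtr // -v2 sumr_ge0 // => k _; exact: sqr_ge0.
(* When [x] is plus or minus the [i]-th basis vector, the tangential part [v] vanishes and cannot be
   normalised. *)
have [s0|s0] := eqVneq s 0.
  have vk k : v 0 k = 0.
    apply/eqP; rewrite -sqrf_eq0; move/eqP: v2; rewrite -s2 s0 expr0n /=.
    by rewrite psumr_eq0 => [/allP/(_ k)|l _]; [apply; rewrite mem_index_enum | exact: sqr_ge0].
  by rewrite big1 ?Normc.normc0 ?s0 ?mul0r // => k _; rewrite vk mul0r.
rewrite (eq_bigr (fun k => s%:C%C * (((s^-1 *: v) 0 k)%:C%C * rmeval (mderiv k p) x))).
  rewrite -mulr_sumr Normc.normcM normc_real ger0_norm ?sqrtr_ge0 //.
  rewrite ler_wpM2l ?sqrtr_ge0 // tangential_deriv_le //.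
    apply/sphereE; under eq_bigr do rewrite mxE exprMn.
    by rewrite -mulr_sumr v2 -s2 -exprMn mulVf // expr1n.
  under eq_bigr do rewrite mxE mulrCA.
  by rewrite -mulr_sumr xv mulr0.
by move=> k _; rewrite [(_ *: v) 0 k]mxE rmorphM mulrA mulrA -rmorphM mulfV // rmorph1 mul1r.
Qed.

Lemma coord_le1 (x : 'rV[R]_n) (i : 'I_n) : sphere x -> x 0 i ^+ 2 <= 1.
Proof.
move=> /sphereE <-; rewrite (bigD1 i) //= lerDl sumr_ge0 // => k _.
exact: sqr_ge0.
Qed.

Lemma partial_deriv_le (x : 'rV[R]_n) (i : 'I_n) : sphere x ->
  normc (rmeval (mderiv i p) x) <= Num.sqrt 2 * d%:R * K.
Proof.
move=> xS; have [T -> TK] := partial_deriv_split i xS.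
have K0 : 0 <= K by exact: le_trans (normc_ge0 _) (pK xS).
rewrite (le_trans (le_normcD _ _)) //.
rewrite Normc.normcM normc_real Normc.normcM normc_nat.
set s := Num.sqrt (1 - _) in TK *.
have s2 : s ^+ 2 = 1 - x 0 i ^+ 2 by rewrite sqr_sqrtr // subr_ge0 coord_le1.
apply: (@le_trans _ _ ((`|x 0 i| + s) * (d%:R * K))).
  by rewrite mulrDl lerD // ler_wpM2l // ler_wpM2l // pK.
rewrite -mulrA ler_wpM2r // ?mulr_ge0 //.
(* Squaring reduces [|x_i| + s <= sqrt 2] to [(|x_i| - s)^2 >= 0], as [x_i^2 + s^2 = 1]. *)
rewrite -(@ler_pXn2r _ 2) ?nnegrE ?addr_ge0 ?sqrtr_ge0 //.
rewrite sqr_sqrtr // sqrrD s2 real_normK ?num_real //.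
have := sqr_ge0 (`|x 0 i| - s); rewrite sqrrB s2 real_normK ?num_real //; lra.
Qed.

(* Euler's identity turns the radial part of [d_i p - m x_i p] into
   [(d - m) x_i p]: only the excess of [m] over the degree is paid for. *)
Lemma shifted_deriv_le (x : 'rV[R]_n) (i : 'I_n) (k : nat) : sphere x ->
  normc (rmeval (mderiv i p) x - (d + k)%:R * ((x 0 i)%:C%C * rmeval p x)) <=
  (d + k)%:R * K.
Proof.
move=> xS; have [T -> TK] := partial_deriv_split i xS.
have K0 : 0 <= K by exact: le_trans (normc_ge0 _) (pK xS).
have -> : (x 0 i)%:C%C * (d%:R * rmeval p x) + T -
    (d + k)%:R * ((x 0 i)%:C%C * rmeval p x) =
    T + - (k%:R * ((x 0 i)%:C%C * rmeval p x)) by rewrite natrD; ring.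
rewrite (le_trans (le_normcD _ _)) // natrD mulrDl lerD //.
  rewrite (le_trans TK) // ler_piMl ?mulr_ge0 // -[leRHS]sqrtr1.
  by rewrite ler_wsqrtr // gerBl sqr_ge0.
rewrite normcN !Normc.normcM normc_nat ler_wpM2l // normc_real.
rewrite -[leRHS]mul1r ler_pM ?normc_ge0 ?pK //.
by rewrite -(@ler_pXn2r _ 2) ?nnegrE // real_normK ?num_real // expr1n coord_le1.
Qed.

End SphereBounds.

(** * Iterated derivatives *)

Lemma is_derive_line (R : realType) (V : normedModType R) (x v : V)
    (f : V -> R) (l : R) :
  is_derive x v f l <-> is_derive (0 : R) 1 (fun h : R => f (h *: v + x)) l.
Proof.
have E : 'D_1 (fun h : R => f (h *: v + x)) 0 = 'D_v f x.
  rewrite /derive; set g1 := fun h => h^-1 *: _; set g2 := fun h => h^-1 *: _.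
  suff -> : g1 = g2 by [].
  by apply/funext => h; rewrite /g1 /g2 /= addr0 scale0r add0r [_%:A]mulr1.
split=> -[df fl]; split.
- exact: (derivable1P f x v).1 df.
- by rewrite E.
- exact: (derivable1P f x v).2 df.
- by rewrite -E.
Qed.

Lemma is_cderive_line (R : realType) (V : normedModType R) (x v : V)
    (F : V -> R[i]) (l : R[i]) :
  is_cderive (0 : R) 1 (fun h : R => F (h *: v + x)) l -> is_cderive x v F l.
Proof. by move=> [dR dI]; split; apply/is_derive_line. Qed.

Lemma is_cderive_shift (R : realType) (V : normedModType R) (c x v : V)
    (F : V -> R[i]) (l : R[i]) :
  is_cderive (c + x) v F l -> is_cderive x v (fun y => F (c + y)) l.
Proof.
move=> [/is_derive_line dR /is_derive_line dI].
by apply: is_cderive_line; split => /=; under eq_fun do rewrite addrCA.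
Qed.

Lemma is_cderive_sum (R : realType) (V : normedModType R) (x v : V) (m : nat)
    (F : 'I_m -> V -> R[i]) (l : 'I_m -> R[i]) :
  (forall r, is_cderive x v (F r) (l r)) ->
  is_cderive x v (fun y => \sum_r F r y) (\sum_r l r).
Proof.
move=> dF; elim: m F l dF => [|m IH] F l dF.
  apply: (is_cderive_eq (is_cderive_cst x v 0)) => [y|]; by rewrite big_ord0.
apply: (is_cderive_eq (is_cderiveD (dF ord0)
  (IH _ _ (fun r => dF (lift ord0 r))))) => [y|]; by rewrite big_ord_recl.
Qed.

(** [P] sees only how many derivatives have been taken, so one step for an arbitrary index [i]
    suffices and partial derivatives never have to be permuted. *)
Lemma mpderiv_ind (R : realType) (n : nat)
    (P : nat -> ('rV[R]_n -> R[i]) -> Prop) (F : 'rV[R]_n -> R[i])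
    (a : multinom n) :
  (forall i k G, P k G -> P k.+1 (pderiv i G)) -> P 0 F ->
  P (mdeg a) (mpderiv a F).
Proof.
move=> PS P0; rewrite /mpderiv mdegE -big_enum /=.
elim: (enum 'I_n) => [|i s IH] /=; first by rewrite big_nil.
rewrite big_cons; elim: (a i) => [|m IHm] //=.
by rewrite addSn; exact: PS.
Qed.

Lemma mpderiv_rmeval_le (R : realType) (n j : nat) (p : mpoly n R[i]) (K : R)
    (a : multinom n) :
  p \is ishomog1 j mdeg -> (forall x, sphere x -> normc (rmeval p x) <= K) ->
  forall x, sphere x ->
    normc (mpderiv a (rmeval p) x) <= (Num.sqrt 2 * j%:R) ^+ mdeg a * K.
Proof.
move=> hp pK.
(* The induction carries the polynomial along: its degree stays at most [j], hence the same factor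
   at each step. Past [j] derivatives the truncated degree remains 0, in accordance with
   [mderiv_homog]. *)
suff [q [_ -> H]] : exists q, [/\ q \is ishomog1 (j - mdeg a) mdeg,
  mpderiv a (rmeval p) = rmeval q & forall x, sphere x ->
    normc (rmeval q x) <= (Num.sqrt 2 * j%:R) ^+ mdeg a * K] by [].
apply: (mpderiv_ind (P := fun m G => exists q, [/\ q \is ishomog1 (j - m) mdeg,
  G = rmeval q & forall x, sphere x ->
    normc (rmeval q x) <= (Num.sqrt 2 * j%:R) ^+ m * K])); last first.
  by exists p; split; rewrite ?subn0 // => x /pK; rewrite expr0 mul1r.
move=> i m _ [q [hq -> qK]]; exists (mderiv i q); split.
- by rewrite subnS; exact: mderiv_homog.
- exact: pderiv_rmeval.
move=> x xS; rewrite (le_trans (partial_deriv_le hq qK i xS)) //.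
rewrite exprS -[leRHS]mulrA ler_wpM2r //.
  exact: le_trans (normc_ge0 _) (qK _ xS).
by rewrite ler_wpM2l ?sqrtr_ge0 // ler_nat leq_subr.
Qed.

(** * Spherical coordinates *)

(** With [S k] the product of the first [k] squared sines, the squared coordinates are
    [S k - S k.+1], except the last, which is [S m]; the sum telescopes to [S 0 = 1]. *)
Lemma sph_coord_sphere (R : realType) (n : nat) (t : 'rV[R]_n.-1) :
  (0 < n)%N -> sphere (@sph_coord R n t).
Proof.
case: n t => // m t _; apply/sphereE => /=; rewrite /= in t *.
pose S k := \prod_(i < m | (i < k)%N) sin (t 0 i) ^+ 2.
rewrite (eq_bigr (fun k : 'I_m.+1 => S k *
  \prod_(i < m | i == k :> nat) cos (t 0 i) ^+ 2)) => [|k _]; last first.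
  by rewrite mxE exprMn -!prodrXl.
rewrite big_ord_recr /= [X in _ + _ * X]big_pred0 ?mulr1; last first.
  by move=> i; apply/negbTE; rewrite ltn_eqF.
rewrite (eq_bigr (fun k : 'I_m => S k - S k.+1)) => [|k _].
  rewrite (eq_bigr (fun k : 'I_m => - (S k.+1 - S k))) => [|k _]; last by rewrite opprB.
  rewrite sumrN -(big_mkord xpredT (fun k => S k.+1 - S k)) telescope_sumr //.
  by rewrite opprB subrK /S big_pred0.
rewrite (big_pred1 k) => [|i]; last by [].
have -> : S k.+1 = S k * sin (t 0 k) ^+ 2.
  rewrite /S (bigD1 k) //= mulrC; congr (_ * _); apply: eq_bigl => i.
  by rewrite ltnS ltn_neqAle andbC.
by rewrite cos2sin2; ring.
Qed.

(** Each angle enters a coordinate at most once: through its sine if [i < k], its cosine if [i = k],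
    and not at all if [i > k]. The addition formulas then give the form that [riesz_meval]
    requires. *)
Lemma sph_coord_line (R : realType) (n : nat) (t : 'rV[R]_n.-1) (i : 'I_n.-1)
    (k : 'I_n) :
  exists c : R * R * R, forall s : R,
    @sph_coord R n (s *: delta_mx 0 i + t) 0 k =
    c.1.1 + cos s * c.1.2 + sin s * c.2.
Proof.
pose u s : 'rV[R]_n.-1 := s *: delta_mx 0 i + t.
have uE s l : u s 0 l = if l == i then s + t 0 i else t 0 l.
  rewrite !mxE; case: (eqVneq l i) => [->|li] /=; first by rewrite mulr1.
  by rewrite mulr0 add0r.
have prodE (f : R -> R) (P : pred 'I_n.-1) s : P i ->
    \prod_(l < n.-1 | P l) f (u s 0 l) =
    f (s + t 0 i) * \prod_(l < n.-1 | P l && (l != i)) f (t 0 l).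
  move=> Pi; rewrite (bigD1 i) //= uE eqxx; congr (_ * _).
  by apply: eq_bigr => l /andP[_ /negbTE li]; rewrite uE li.
have prodE' (f : R -> R) (P : pred 'I_n.-1) s : ~~ P i ->
    \prod_(l < n.-1 | P l) f (u s 0 l) = \prod_(l < n.-1 | P l) f (t 0 l).
  move=> Pi; apply: eq_bigr => l Pl; rewrite uE; case: eqVneq => // li.
  by rewrite -li Pl in Pi.
have [ik|ki|ik] := ltngtP i k.
- set b := \prod_(l < n.-1 | (l < k)%N && (l != i)) sin (t 0 l).
  set c := \prod_(l < n.-1 | l == k :> nat) cos (t 0 l).
  exists (0, sin (t 0 i) * b * c, cos (t 0 i) * b * c) => s.
  rewrite mxE prodE // prodE' -/b -/c ?sinD /=; first by ring.
  by rewrite ltn_eqF.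
- set b := \prod_(l < n.-1 | (l < k)%N) sin (t 0 l).
  set c := \prod_(l < n.-1 | l == k :> nat) cos (t 0 l).
  exists (b * c, 0, 0) => s.
  rewrite mxE !prodE' -/b -/c /=; first by ring.
    by rewrite gtn_eqF.
  by rewrite -leqNgt ltnW.
- set b := \prod_(l < n.-1 | (l < k)%N) sin (t 0 l).
  set c := \prod_(l < n.-1 | (l == k :> nat) && (l != i)) cos (t 0 l).
  exists (0, b * cos (t 0 i) * c, - (b * sin (t 0 i) * c)) => s.
  rewrite mxE prodE' -/b ?prodE -/c ?cosD /=; first by ring.
    exact/eqP.
  by rewrite -leqNgt ik.
Qed.

(* Riesz' formula makes each angular derivative a fixed finite combination of
   translates, so it survives differentiation together with the bound. *)
Lemma mpderiv_sph_coord_le (R : realType) (n j : nat) (p : mpoly n R[i]) (K : R)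
    (a : multinom n.-1) :
  (0 < n)%N -> p \is ishomog1 j mdeg ->
  (forall x, sphere x -> normc (rmeval p x) <= K) ->
  forall t, normc (mpderiv a (rmeval p \o @sph_coord R n) t) <=
    j%:R ^+ mdeg a * K.
Proof.
move=> n0 hp pK; have [w [th [wE H]]] := riesz_meval R j.
pose T (i : 'I_n.-1) (G : 'rV[R]_n.-1 -> R[i]) (t : 'rV[R]_n.-1) :=
  \sum_r w r * G (th r *: delta_mx 0 i + t).
have TK i G B : (forall t, normc (G t) <= B) ->
    forall t, normc (T i G t) <= j%:R * B.
  move=> GB t; rewrite (le_trans (normc_sum _ _ _)) // -wE mulr_suml ler_sum //.
  by move=> r _; rewrite Normc.normcM ler_wpM2l ?normc_ge0 ?GB.
suff [_ Hle] : (forall t i, is_cderive t (delta_mx 0 i)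
    (mpderiv a (rmeval p \o @sph_coord R n))
    (T i (mpderiv a (rmeval p \o @sph_coord R n)) t)) /\
  (forall t, normc (mpderiv a (rmeval p \o @sph_coord R n) t) <=
    j%:R ^+ mdeg a * K) by [].
apply: (mpderiv_ind (P := fun m G =>
  (forall t i, is_cderive t (delta_mx 0 i) G (T i G t)) /\
  (forall t, normc (G t) <= j%:R ^+ m * K))).
  move=> i m G [dG GK]; have -> : pderiv i G = T i G.
    by apply/funext => t; apply: is_cderive_pderiv; exact: dG.
  split=> [t l|t]; last by rewrite exprS -mulrA; exact: TK.
  have dT r : is_cderive t (delta_mx 0 l)
      (fun y => w r * G (th r *: delta_mx 0 i + y))
      (w r * T l G (th r *: delta_mx 0 i + t)).
    apply: (is_cderive_eq (is_cderiveM (is_cderive_cst t (delta_mx 0 l) (w r))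
      (is_cderive_shift (dG (th r *: delta_mx 0 i + t) l)))) => //.
    by rewrite mul0r add0r.
  apply: (is_cderive_eq (is_cderive_sum dT)) => //.
  (* Translations in the directions [i] and [l] commute, so the two sums can be exchanged. *)
  rewrite /T; under eq_bigr do rewrite mulr_sumr; under [in RHS]eq_bigr do rewrite mulr_sumr.
  rewrite exchange_big /=; apply: eq_bigr => r _; apply: eq_bigr => u _.
  by rewrite mulrCA [_ *: _ + (_ + _)]addrCA.
split=> [t i|t]; last first.
  by rewrite expr0 mul1r; apply: pK; exact: sph_coord_sphere.
(* For the undifferentiated function, the formula is [riesz_meval] at [s = 0] on the line through
   [t] in direction [i]. *)
have [c cE] := choice (sph_coord_line t i).
apply: is_cderive_line.
pose f s := meval (fun k => (c k).1.1%:C%C + (cos s)%:C%C * (c k).1.2%:C%C +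
  (sin s)%:C%C * (c k).2%:C%C) p.
have fE s : f s = (rmeval p \o @sph_coord R n) (s *: delta_mx 0 i + t).
  by apply: meval_eq => k; rewrite cE !rmorphD !rmorphM.
apply: (is_cderive_eq (H _ _ _ _ _ 0 hp) fE).
by apply: eq_bigr => r _; rewrite add0r -fE.
Qed.

(** * The homogeneous extension of order 0 *)

Lemma near_neq0 (R : realType) (V : normedModType R) (x : V) :
  x != 0 -> \near x, x != 0.
Proof.
move=> x0; apply/nbhs_ballP; exists `|x|; first by rewrite /= normr_gt0.
move=> y /=; rewrite -ball_normE /= => xy; apply: contraTneq xy => ->.
by rewrite subr0 ltxx.
Qed.

Lemma enorm_gt0 (R : realType) (n : nat) (x : 'rV[R]_n) : x != 0 -> 0 < enorm x.
Proof.
move=> x0; rewrite sqrtr_gt0 lt_neqAle sumr_ge0 => [|i _]; last exact: sqr_ge0.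
rewrite andbT eq_sym psumr_eq0 => [|i _]; last exact: sqr_ge0.
apply: contra x0 => /allP H; apply/eqP/rowP => i; apply/eqP.
by have := H i (mem_index_enum _); rewrite /= sqrf_eq0 mxE.
Qed.

Lemma enorm_sqr (R : realType) (n : nat) (x : 'rV[R]_n) :
  enorm x ^+ 2 = \sum_i x 0 i ^+ 2.
Proof. by rewrite sqr_sqrtr // sumr_ge0 // => i _; exact: sqr_ge0. Qed.

Lemma is_derive_enormV (R : realType) (n : nat) (x v : 'rV[R]_n) : x != 0 ->
  is_derive x v (fun y => (enorm y)^-1)
    (- (\sum_i x 0 i * v 0 i) * (enorm x)^-1 ^+ 3).
Proof.
move=> x0; have e0 := enorm_gt0 x0.
have dq : is_derive x v (fun y : 'rV[R]_n => \sum_i y 0 i ^+ 2)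
    (2 * \sum_i x 0 i * v 0 i).
  rewrite (_ : (fun y => _) = \sum_i (fun y : 'rV[R]_n => y 0 i) ^+ 2); last first.
    by apply/funext => y; rewrite fct_sumE.
  apply: (is_derive_eq (is_derive_sum (fun i => is_deriveX 2 (is_derive_coord x v i)))).
  by rewrite mulr_sumr; apply: eq_bigr => i _; rewrite /GRing.scale /= expr1 mulrA.
have de : is_derive x v (@enorm R n) ((\sum_i x 0 i * v 0 i) * (enorm x)^-1).
  have q0 : 0 < \sum_i x 0 i ^+ 2 by rewrite -enorm_sqr exprn_gt0.
  apply/is_derive_line; have /is_derive_line dq' := dq.
  have ds : is_derive (\sum_i (0 *: v + x) 0 i ^+ 2 : R) 1 Num.sqrt (2 * enorm x)^-1.
    by rewrite scale0r add0r; exact: is_derive1_sqrt.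
  have := is_derive1_comp ds dq'.
  by move=> d; apply: (is_derive_eq d); rewrite /GRing.scale /=; field; rewrite gt_eqF.
have eV : (enorm x) != 0 by rewrite gt_eqF.
split; first by apply: derivableV => //; case: de.
rewrite deriveV //.
rewrite (@derive_val _ _ _ _ _ _ _ de).
set e := enorm x in eV *; set q := (\sum_i _).
rewrite [LHS](_ : _ = - e ^- 2 * (q * e^-1)) //; field.
exact: eV.
Qed.

Lemma mpderiv_homext_le (R : realType) (n j : nat) (p : mpoly n R[i]) (K : R)
    (a : multinom n) (Y : 'rV[R]_n -> R[i]) :
  p \is ishomog1 j mdeg -> (forall x, sphere x -> Y x = rmeval p x) ->
  (forall x, sphere x -> normc (rmeval p x) <= K) ->
  forall x, sphere x ->
    normc (sphere_deriv a Y x) <= (\prod_(k < mdeg a) (j + 2 * k))%:R * K.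
Proof.
move=> hp Yp pK.
pose B m : R := (\prod_(k < m) (j + 2 * k))%:R * K.
(* After [m] derivatives: a numerator of degree [j + m] over [|x|^(j + 2m)]. The identity is asked
   off the origin only, where [homext] is meaningful. *)
pose P m (G : 'rV[R]_n -> R[i]) := exists q, [/\ q \is ishomog1 (j + m) mdeg,
  forall x, x != 0 -> G x = ((enorm x)^-1)%:C%C ^+ (j + 2 * m) * rmeval q x &
  forall x, sphere x -> normc (rmeval q x) <= B m].
have sn0 x : @sphere R n x -> x != 0.
  move=> /sphereE x1; apply/eqP => x0; move: x1; rewrite x0 big1.
    by move/esym/eqP; rewrite oner_eq0.
  by move=> k _; rewrite mxE expr0n.
suff [q [_ qE qK]] : P (mdeg a) (sphere_deriv a Y).
  move=> x xS; rewrite qE ?sn0 //; have -> : enorm x = 1 by exact: xS.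
  by rewrite invr1 expr1n mul1r; exact: qK.
apply: mpderiv_ind => [i m G [q [hq GE qK]]|]; last first.
  exists p; split; rewrite ?addn0 //.
    move=> x x0; have e0 := enorm_gt0 x0; rewrite /homext Yp ?(rmevalZ _ _ hp) ?muln0 ?addn0 //.
    apply/sphereE; under eq_bigr do rewrite mxE exprMn.
    by rewrite -mulr_sumr -enorm_sqr -exprMn mulVf ?expr1n // gt_eqF.
  by move=> x xS; rewrite /B big_ord0 mul1r; exact: pK.
pose E : mpoly n R[i] := \sum_k mpolyX R[i] (mnm1 k) ^+ 2.
have EE x : rmeval E x = (enorm x ^+ 2)%:C%C.
  rewrite /rmeval /E enorm_sqr !rmorph_sum /=; apply: eq_bigr => k _.
  by rewrite !rmorphXn /= mevalXU.
have hX k : mpolyX R[i] (mnm1 k : multinom n) \is ishomog1 1 mdeg.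
  by rewrite dhomogX /= mdeg1.
have hE : E * mderiv i q \is ishomog1 (j + m).+1 mdeg.
  (* In degree 0 the truncated predecessor would give the product the wrong degree, but then the
     derivative is zero. *)
  have [d0|d0] := posnP (j + m).
    by rewrite mderiv_homog0 ?mulr0 ?dhomog0 //; move: hq; rewrite d0.
  rewrite (_ : (j + m).+1 = (2 + (j + m).-1)%N); last by lia.
  apply: dhomogM (mderiv_homog i hq); apply: rpred_sum => k _.
  by rewrite -[2%N]mul1n; exact: dhomogMn.
have hXq : mpolyX R[i] (mnm1 i) * q \is ishomog1 (j + m).+1 mdeg.
  by rewrite -add1n; exact: dhomogM.
(* The new numerator, over [|x|^(j + 2m + 2)]; [E] is [|x|^2]. On the sphere it is the expression of
   [shifted_deriv_le] for degree [j + m] and excess [k = m]. *)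
pose q' := E * mderiv i q - (j + 2 * m)%:R *: (mpolyX R[i] (mnm1 i) * q).
have q'E x : rmeval q' x = (enorm x ^+ 2)%:C%C * rmeval (mderiv i q) x -
    (j + 2 * m)%:R * ((x 0 i)%:C%C * rmeval q x).
  by rewrite /rmeval mevalB mevalZ !mevalM mevalXU -[meval _ E]/(rmeval E x) EE.
exists q'; split.
- by rewrite addnS; apply: rpredB => //; exact: dhomogZ.
- move=> x x0; apply: is_cderive_pderiv.
  have dV := is_cderive_realC (is_derive_enormV (delta_mx 0 i) x0).
  have dq : is_cderive x (delta_mx 0 i) (rmeval q) (rmeval (mderiv i q) x).
    exact: is_cderive_rmeval.
  apply: (is_cderive_near (F := fun y => ((enorm y)^-1)%:C%C ^+ (j + 2 * m) *
    rmeval q y)).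
    by apply: filterS (near_neq0 x0) => y /GE.
  apply: (is_cderive_eq (is_cderiveM (is_cderiveX (j + 2 * m) dV) dq)) => //.
  rewrite q'E (bigD1 i) //= big1 => [|k ki]; last first.
    by rewrite mxE (negbTE ki) andbF mulr0.
  rewrite mxE !eqxx mulr1 addr0 mulNr rmorphN rmorphM !rmorphXn /=.
  have Ve : ((enorm x)^-1)%:C%C * (enorm x)%:C%C = 1 :> R[i].
    by rewrite -rmorphM mulVf ?rmorph1 // gt_eqF ?enorm_gt0.
  move: ((enorm x)^-1)%:C%C (enorm x)%:C%C Ve => V e Ve.
  rewrite (_ : j + 2 * m.+1 = j + 2 * m + 2)%N; last by lia.
  move: (j + 2 * m)%N => d; have Ve2 : V ^+ 2 * e ^+ 2 = 1.
    by rewrite -exprMn Ve expr1n.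
  have -> D c : V ^+ (d + 2) * (e ^+ 2 * D - c) =
      V ^+ d * (V ^+ 2 * e ^+ 2) * D - V ^+ d * V ^+ 2 * c.
    by rewrite exprD; ring.
  rewrite Ve2 mulr1; case: d => [|b]; first by ring.
  by rewrite /= [V ^+ b.+1]exprS; ring.
move=> x xS; rewrite q'E (_ : enorm x = 1) // expr1n mul1r.
have := shifted_deriv_le hq qK i m xS.
rewrite -addnA addnn -mul2n => /le_trans; apply.
by rewrite /B big_ord_recr /= natrM [_ * (j + _)%:R]mulrC mulrA.
Qed.

(** * Norms and constants *)

Lemma rmeval_bounded (R : realType) (n : nat) (p : mpoly n R[i]) :
  exists K, forall x : 'rV[R]_n, sphere x -> normc (rmeval p x) <= K.
Proof.
elim/mpoly_ring_ind: p => [c|i|p q [K pK] [L qL]|p q [K pK] [L qL]].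
- by exists (normc c) => x _; rewrite /rmeval mevalC.
- exists 1 => x xS; rewrite /rmeval mevalXU normc_real.
  by rewrite -(@ler_pXn2r _ 2) ?nnegrE // real_normK ?num_real // expr1n coord_le1.
- exists (K + L) => x xS; rewrite /rmeval mevalD.
  by rewrite (le_trans (le_normcD _ _)) // lerD ?pK ?qL.
- exists (K * L) => x xS; rewrite /rmeval mevalM Normc.normcM.
  by rewrite ler_pM ?normc_ge0 ?pK ?qL.
Qed.

(** On a non-empty [S] where [F] is bounded, the supremum is a real number and itself an admissible
    [K]; so the estimates are proved for real bounds and transferred to extended reals here once. *)
Lemma supnorm_le (R : realType) (T U : Type) (A : set T) (S : set U)
    (G : T -> R[i]) (F : U -> R[i]) (c : R) :
  S !=set0 -> (exists K, forall x, S x -> normc (F x) <= K) ->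
  (forall K, 0 <= K -> (forall x, S x -> normc (F x) <= K) ->
     forall y, A y -> normc (G y) <= c * K) ->
  (supnorm A G <= c%:E * supnorm S F)%E.
Proof.
move=> [x0 Sx0] [K FK] H.
have Fle x : S x -> ((normc (F x))%:E <= supnorm S F)%E.
  by move=> Sx; apply: ereal_sup_ubound; exists x.
have leK : (supnorm S F <= K%:E)%E.
  by apply: ge_ereal_sup => _ [x Sx <-]; rewrite lee_fin FK.
have [k kE] : exists k, supnorm S F = k%:E.
  by move: (Fle _ Sx0) leK; case: (supnorm S F) => [k _ _||] //; exists k.
move: Fle; rewrite kE => Fle.
apply: ge_ereal_sup => _ [y Ay <-]; rewrite -EFinM lee_fin; apply: H => //.
by have := Fle _ Sx0; rewrite lee_fin; exact: le_trans (normc_ge0 _).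
Qed.

Lemma sphere_nonempty (R : realType) (n : nat) : (0 < n)%N ->
  @sphere R n !=set0.
Proof.
case: n => // n _; exists (delta_mx 0 ord0); apply/sphereE.
rewrite (bigD1 ord0) //= big1 => [|k k0]; first by rewrite mxE !eqxx expr1n addr0.
by rewrite mxE (negbTE k0) andbF expr0n.
Qed.

(** For [j = 0] the left side vanishes as [m] is positive; otherwise the exponent grows over a base
    at least 1. *)
Lemma exprn_le_powR (R : realType) (j m : nat) (r : R) : (0 < m)%N -> 0 <= r ->
  j%:R ^+ m <= j%:R `^ (m%:R + r).
Proof.
move=> m0 r0; case: j => [|j]; first by rewrite expr0n gtn_eqF // powR_ge0.
by rewrite -powR_mulrn ?ler0n // ler_powR ?ler1n // lerDl.
Qed.

Lemma powR_half_nat (R : realType) (m : nat) :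
  2 `^ (m%:R / 2) = Num.sqrt 2 ^+ m :> R.
Proof.
by rewrite mulrC powRrM powR12_sqrt // powR_mulrn ?sqrtr_ge0.
Qed.

(** For [j >= 1] each factor satisfies [j + 2k <= 2 (k + 1) j]; for [j = 0] the factor [k = 0],
    present because [0 < m], vanishes. *)
Lemma prod_arith_le (j m : nat) : (0 < m)%N ->
  (\prod_(k < m) (j + 2 * k) <= 2 ^ m * m`! * j ^ m)%N.
Proof.
case: j => [|j m0].
  by case: m => // m _; rewrite big_ord_recl.
elim: m {m0} => [|m IH]; first by rewrite big_ord0.
rewrite big_ord_recr /= (leq_trans (leq_mul IH (_ : _ <= 2 * m.+1 * j.+1)%N)) //.
  nia.
by rewrite factS !expnS; apply: eq_leq; ring.
Qed.
Set Strict Implicit.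
Unset Implicit Arguments.

Theorem theorem3p1 (R : realType) (n : nat) (hn : (2 <= n)%N) (j : nat) :
  (forall Q : 'rV[R]_n -> R[i], solid_harmonic j Q ->
   forall a : multinom n, a != mnm0 ->
     (supnorm (@sphere R n) (mpderiv a Q) <=
      (expR (n%:R / 4 - 1 / 2) * Num.sqrt n%:R
        * 2 `^ ((mdeg a)%:R / 2)
        * j%:R `^ ((mdeg a)%:R + n%:R / 2 - 1))%:E
      * supnorm (@sphere R n) Q)%E)
  /\
  (forall Y : 'rV[R]_n -> R[i], spherical_harmonic j Y ->
   forall a : multinom n.-1, a != mnm0 ->
     (supnorm [set: 'rV[R]_n.-1] (mpderiv a (Y \o @sph_coord R n)) <=
      (expR (n%:R / 4 - 1 / 2) * Num.sqrt n%:R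
        * ((n%:R + 1) ^+ mdeg a - 1)
        * 2 `^ ((mdeg a)%:R / 2)
        * j%:R `^ ((mdeg a)%:R + n%:R / 2 - 1))%:E
      * supnorm (@sphere R n) Y)%E)
  /\
  (forall Y : 'rV[R]_n -> R[i], spherical_harmonic j Y ->
   forall a : multinom n, a != mnm0 ->
   forall eps : R, 0 < eps ->
     (supnorm (@sphere R n) (sphere_deriv a Y) <=
      (expR (n%:R * (1 / 4 + Num.sqrt 2 + 3 * Num.sqrt (2 + 4 / eps)) - 1 / 2)
        * n%:R `^ (((mdeg a)%:R + 1) / 2)
        * (2 + eps) ^+ mdeg a
        * j%:R `^ ((mdeg a)%:R + n%:R / 2 - 1)
        * ((mdeg a)`!)%:R)%:E
      * supnorm (@sphere R n) Y)%E).
Proof.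
(* The bounds proved above are at most the stated ones. The next facts show that surplus factors are
   at least 1; [2 <= n] makes [n / 4 - 1 / 2] and [n / 2 - 1] nonnegative. *)
have n0 : (0 < n)%N by exact: leq_trans hn.
have n2 : 2 <= n%:R :> R by rewrite ler_nat.
have nR : 1 <= n%:R :> R by rewrite ler1n.
have r0 : 0 <= n%:R / 2 - 1 :> R by lra.
have S1 : 1 <= Num.sqrt n%:R :> R by rewrite -[leLHS]sqrtr1 ler_wsqrtr.
have E1 : 1 <= expR (n%:R / 4 - 1 / 2) :> R by rewrite -[leLHS]expR0 ler_expR; lra.
have P1 m : 1 <= 2 `^ (m%:R / 2) :> R.
  by rewrite powR_half_nat exprn_ege1 // -[leLHS]sqrtr1 ler_wsqrtr // ler1n.
have J m : (0 < m)%N -> j%:R ^+ m <= j%:R `^ (m%:R + n%:R / 2 - 1) :> R.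
  by move=> m0; rewrite -addrA exprn_le_powR.
have a0 l (a : multinom l) : a != mnm0 -> (0 < mdeg a)%N by rewrite lt0n mdeg_eq0.
have ne : @sphere R n !=set0 by exact: sphere_nonempty.
split; [|split].
- move=> Q [[p hp QE] _] a /a0 m0.
  have -> : Q = rmeval p by apply/funext.
  apply: supnorm_le => //; first exact: rmeval_bounded.
  move=> K K0 pK x xS; rewrite (le_trans (mpderiv_rmeval_le a hp pK xS)) //.
  rewrite ler_wpM2r // exprMn powR_half_nat ler_pM ?J ?exprn_ge0 ?sqrtr_ge0 //.
  by rewrite ler_peMl ?mulr_ege1 // exprn_ge0 ?sqrtr_ge0.
- move=> Y [Q [[p hp QE] _] YQ] a /a0 m0.
  have YE x : sphere x -> Y x = rmeval p x by move=> xS; rewrite YQ ?inE.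
  have -> : Y \o @sph_coord R n = rmeval p \o @sph_coord R n.
    by apply/funext => t /=; rewrite YE //; exact: sph_coord_sphere.
  apply: supnorm_le => //.
    have [K pK] := rmeval_bounded p; exists K => x xS; by rewrite YE ?pK.
  move=> K K0 pK t _.
  rewrite (le_trans (mpderiv_sph_coord_le a n0 hp (K := K) _ t)) //.
    by move=> x xS; rewrite -YE ?pK.
  rewrite ler_wpM2r // (le_trans (J _ m0)) // ler_peMl ?powR_ge0 //.
  (* As [mdeg a] is positive, [(n + 1) ^+ mdeg a - 1] is at least [n]. *)
  rewrite !mulr_ege1 // lerBrDr (@le_trans _ _ (n%:R + 1)) ?lerD2r //.
  by rewrite -[leLHS]expr1 ler_weXn2l // ler_wpDl ?ler0n.
- move=> Y [Q [[p hp QE] _] YQ] a /a0 m0 eps eps0.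
  have YE x : sphere x -> Y x = rmeval p x by move=> xS; rewrite YQ ?inE.
  apply: supnorm_le => //.
    have [K pK] := rmeval_bounded p; exists K => x xS; by rewrite YE ?pK.
  move=> K K0 pK x xS.
  rewrite (le_trans (mpderiv_homext_le (K := K) a hp YE _ xS)) //.
    by move=> y yS; rewrite -YE ?pK.
  rewrite ler_wpM2r //.
  (* The power of 2 will be absorbed by [(2 + eps) ^+ mdeg a]; the exponential and the power of [n]
     are at least 1. *)
  apply: (@le_trans _ _ (2 ^ mdeg a * (mdeg a)`! * j ^ mdeg a)%:R).
    by rewrite ler_nat prod_arith_le.
  rewrite !natrM !natrX mulrAC ler_wpM2r ?ler0n //.
  rewrite ler_pM ?exprn_ge0 ?J //.
  apply: (@le_trans _ _ ((2 + eps) ^+ mdeg a)).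
    by rewrite ler_pXn2r ?nnegrE //; lra.
  rewrite ler_peMl ?exprn_ge0 //; first lra.
  rewrite mulr_ege1 //.
    rewrite -[leLHS]expR0 ler_expR.
    have := sqrtr_ge0 (2 + 4 / eps); have := sqrtr_ge0 (2 : R).
    nra.
  by rewrite -[leLHS](powRr0 n%:R) ler_powR //; have := ler0n R (mdeg a); lra.
Qed.
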